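(* Let $\varphi^t$ be a continuous flow on a metric space $X$ and let $I$ be an isolated invariant set for $\varphi^t$ with a Morse decomposition $\{M_i\}_{i=1}^n$. If $(N,L)$ is an index pair for $I$ and $\nu$ is a category on $N/L$, then $$\nu(N/L)\leq \nu([L])+\sum_{i=1}^n \nu(M_i).$$ Moreover, if $L=\varnothing$, then $\nu(N)\leq \sum_{i=1}^n \nu(M_i)$.
   Context: Flow: $\varphi^t$ ($t\in\mathbb{R}$) is a continuous $\mathbb{R}$-action on $X$. For $J\subset\mathbb{R}$, $\varphi^J(x)=\{\varphi^t(x): t\in J\}$. $\alpha(x)$, $\omega(x)$ are the alpha- and omega-limit sets of $x$. A set $S$ is invariant if $\varphi^t(S)=S$ for all $t\in\mathbb{R}$. Isolated invariant set: a subset $I\subset X$ which is the maximal invariant set in a compact neighborhood of itself; such a neighborhood is called an isolating neighborhood for $I$. Morse decomposition of $I$: a collection $\{M_i\}_{i=1}^n$ where each $M_i$ is an isolated invariant subset of $I$ and for every $x\in I-\bigcup_{i=1}^n M_i$ there exist $i,j\in\{1,\dots,n\}$ such that $i<j$, $\alpha(x)\subset M_i$ and $\omega(x)\subset M_j$. Quotient and induced semi-flow: for a compact pair $(N,L)$ in $X$, $N/L$ is the pointed quotient space obtained by collapsing $L$ to the point $[L]$. No distinction is made between $N-L$ and $N/L-\{[L]\}$, and the $M_i$ are regarded as subsets of $N/L$. The induced semi-flow $\varphi^t_{\#}:N/L\to N/L$ ($t\ge 0$) is $\varphi^t_{\#}(x)=\varphi^t(x)$ if $\varphi^{[0,t]}(x)\subset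 N-L$, and $\varphi^t_{\#}(x)=[L]$ otherwise. Index pair for $I$: a compact pair $(N,L)$ in $X$ such that $\overline{N-L}$ is an isolating neighborhood for $I$ and the induced semi-flow $\varphi^t_{\#}$ is continuous. Category on a topological space $M$: a map $\nu:2^M\to\mathbb{Z}\cup\{+\infty\}$ such that (i) if $A\subset B$ then $\nu(A)\le\nu(B)$; (ii) $\nu(A\cup B)\le\nu(A)+\nu(B)$; (iii) for every $A\subset M$ there is an open set $U\subset M$ with $A\subset U$ and $\nu(A)=\nu(U)$; (iv) if $f:M\to M$ is homotopic to $\mathrm{id}_M$, then $\nu(A)\le\nu(f(A))$ for every $A\subset M$. $\nu([L])$ means $\nu(\{[L]\})$.
   Formalization: The sets M_i of the Morse decomposition are assumed pairwise disjoint and n ≥ 1; without disjointness the claim fails (torus flow with one rest point p, all other orbits homoclinic, M_1 = M_2 = {p}), and for n = 0 the ''Moreover'' clause fails (N empty, ν constantly 1). *)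

(* Defs.v *)
From HB Require Import structures.
From mathcomp Require Import all_boot all_order all_algebra.
From mathcomp Require Import all_classical all_reals all_analysis.

Set Implicit Arguments.
Unset Strict Implicit.
Unset Printing Implicit Defensive.

Import Order.TTheory GRing.Theory Num.Theory.
Import numFieldNormedType.Exports.

Local Open Scope classical_set_scope.
Local Open Scope ring_scope.

Section flow.
Context {R : realType} {X : topologicalType}.
Implicit Types (phi : R -> X -> X) (S K I : set X) (x : X).

Definition is_flow phi : Prop :=
  [/\ continuous (fun z : R * X => phi z.1 z.2),
      forall x, phi 0 x = x &
      forall s t x, phi (s + t) x = phi s (phi t x)].

Definition invariant_set phi S : Prop := forall t, phi t @` S = S.

Definition alpha_limit phi x : set X := cluster (phi t x @[t --> -oo]).

Definition omega_limit phi x : set X := cluster (phi t x @[t --> +oo]).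

Definition maximal_invariant phi K I : Prop :=
  [/\ I `<=` K, invariant_set phi I &
      forall S, S `<=` K -> invariant_set phi S -> S `<=` I].

Definition isolating_neighborhood phi I K : Prop :=
  [/\ compact K, I `<=` K^° & maximal_invariant phi K I].

Definition isolated_invariant phi I : Prop :=
  exists K, isolating_neighborhood phi I K.

(* Disjointness of the members is part of the notion (Conley): without it, the
   family with M_0 = M_1 = {p} would be a Morse decomposition of any flow all of
   whose orbits other than the rest point p are homoclinic to p. *)
Definition morse_decomposition phi I (n : nat) (M : 'I_n -> set X) : Prop :=
  [/\ trivIset setT M,
      forall i, isolated_invariant phi (M i) /\ M i `<=` I &
      forall x, (I `\` \bigcup_i M i) x ->
        exists i j : 'I_n, [/\ (i < j)%N,
          alpha_limit phi x `<=` M i & omega_limit phi x `<=` M j]].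

End flow.

(* The pointed quotient N/L of a pair L `<=` N has N `\` L plus the base point
   [L] = None as underlying set, so that [L] is present even when L is empty:
   N/set0 is then N with an isolated base point added. *)
Definition pquot {X : topologicalType} (N L : set X) : Type :=
  option (set_type (N `\` L)).

(* Meant on N: points of N `\` L go to themselves, points of L to [L]. *)
Definition collapse {X : topologicalType} (N L : set X) (x : X) : pquot N L :=
  insub x.

Section pquot_topology.
Context {X : topologicalType} (N L : set X).

HB.instance Definition _ :=
  Choice.copy (pquot N L) (option (set_type (N `\` L))).
HB.instance Definition _ := isPointed.Build (pquot N L) None.

(* Quotient topology: U is open iff its preimage is open in the subspace N. *)
Definition pquot_open (U : set (pquot N L)) : Prop :=
  open [set x : set_type N | U (collapse N L (val x))].

Let pquot_openT : pquot_open setT.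
Proof. exact: openT. Qed.

Let pquot_openI : setI_closed pquot_open.
Proof. by move=> U V oU oV; exact: openI. Qed.

Let pquot_open_bigcup (T : Type) (f : T -> set (pquot N L)) :
  (forall i, pquot_open (f i)) -> pquot_open (\bigcup_i f i).
Proof. by move=> of_; apply: bigcup_open => i _; exact: of_. Qed.

HB.instance Definition _ := isOpenTopological.Build (pquot N L)
  pquot_openT pquot_openI pquot_open_bigcup.

Lemma collapse_eq (x y : X) : L `<=` N -> N x -> N y ->
  collapse N L x = collapse N L y <-> x = y \/ L x /\ L y.
Proof.
move=> LN Nx Ny; rewrite /collapse; split.
  case: insubP => [u xD <-|xD]; case: insubP => [v yD <-|yD] //.
    by move=> [->]; left.
  move=> _; right; split.
    by apply: contrapT => nL; move: xD; rewrite mem_set.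
  by apply: contrapT => nL; move: yD; rewrite mem_set.
move=> [->//|[Lx Ly]].
by rewrite !insubF //; apply/negbTE/negP; rewrite inE => -[].
Qed.

End pquot_topology.

Section index_pair.
Context {R : realType} {X : topologicalType}.
Implicit Types (phi : R -> X -> X) (N L I : set X).

(* Only meaningful for t >= 0. *)
Definition induced_semiflow phi N L (t : R) (q : pquot N L) : pquot N L :=
  if q is Some x then
    if `[< forall s, 0 <= s <= t -> (N `\` L) (phi s (val x)) >]
    then collapse N L (phi t (val x)) else point
  else point.

Definition compact_pair N L : Prop := [/\ compact N, compact L & L `<=` N].

Definition index_pair phi I N L : Prop :=
  [/\ compact_pair N L,
      isolating_neighborhood phi I (closure (N `\` L)) &
      {within [set z : R * pquot N L | 0 <= z.1],
        continuous (fun z : R * pquot N L => induced_semiflow phi z.1 z.2)}].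

End index_pair.

Definition homotopic (R : realType) {S T : topologicalType} (f g : S -> T) :
    Prop :=
  exists H : R * S -> T,
    [/\ {within [set z : R * S | 0 <= z.1 <= 1], continuous H},
        forall x, H (0, x) = f x & forall x, H (1, x) = g x].

(* Values in Z \cup {+oo}: \bar int without -oo. *)
Record is_category (R : realType) (M : topologicalType)
    (nu : set M -> \bar int) : Prop := {
  category_gtNy : forall A, (-oo < nu A)%E ;
  category_mono : forall A B, A `<=` B -> (nu A <= nu B)%E ;
  category_subadd : forall A B, (nu (A `|` B) <= nu A + nu B)%E ;
  category_open : forall A, exists U, [/\ open U, A `<=` U & nu A = nu U] ;
  category_homotopy : forall f : M -> M, homotopic R f id ->
    forall A, (nu A <= nu (f @` A))%E }.

(* Main.v *)
Require Import Defs.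
From HB Require Import structures.
From mathcomp Require Import all_boot all_order all_algebra.
From mathcomp Require Import all_classical all_reals all_analysis.

Set Implicit Arguments.
Unset Strict Implicit.
Unset Printing Implicit Defensive.

Import Order.TTheory GRing.Theory Num.Theory.
Import numFieldNormedType.Exports.

Local Open Scope classical_set_scope.
Local Open Scope ring_scope.

(** A category bounds nu A by nu U as soon as A can be pushed into U along the
    semi-flow for a time depending continuously on the point. By (iii) there
    are open sets U_0 around [L] and U_i around M_i in N/L with the same
    category as [L] and M_i, so it is enough to cover N/L by sets A_0, ..., A_n
    that can be pushed into U_0, ..., U_n.
    The order of the Morse decomposition forbids cycles of connecting orbits,
    hence there are smaller neighbourhoods V_i of M_i such that an orbit segment
    in N \ L with both ends in V_i stays in U_i. Every orbit staying in N \ L up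
    to some uniform time T meets some V_i, so a point that is not sent to [L] by
    time T visits some V_i. If A_i consists of points visiting V_i, then a
    continuous weighted mean of finitely many visiting times lies between two
    visits, and the point is in U_i at that time. *)

Lemma continuous_at_pair {S T U : topologicalType} (f : S -> T) (g : S -> U) x :
  {for x, continuous f} -> {for x, continuous g} ->
  {for x, continuous (fun y => (f y, g y))}.
Proof. by move=> fx gx; exact: (cvg_pair fx gx). Qed.

(** * Distance to a set, and cluster points of nested sets *)

Section metric_space.
Context {R : realType} {X : metricType R}.
Implicit Types (A K : set X) (x y : X).

(* The cap at 1 gives the empty set the distance 1 instead of inf set0 = 0. *)
Definition setdist A x : R := inf (1 |` [set mdist x a | a in A]).

Let setdist_has_lbound A x : has_lbound (1 |` [set mdist x a | a in A]).
Proof. by exists 0 => _ [->//|[a _ <-]]; exact: mdist_ge0. Qed.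

Let setdist_nonempty A x : 1 |` [set mdist x a | a in A] !=set0.
Proof. by exists 1; left. Qed.

Lemma setdist_ge0 A x : 0 <= setdist A x.
Proof.
by apply: lb_le_inf => // _ [->//|[a _ <-]]; exact: mdist_ge0.
Qed.

Lemma setdist_lipschitz A x y : setdist A x <= mdist x y + setdist A y.
Proof.
rewrite -lerBlDl; apply: lb_le_inf => // _ [->|[a Aa <-]]; rewrite lerBlDl.
  rewrite (@le_trans _ _ 1) ?lerDr ?mdist_ge0//.
  by apply: ge_inf => //; left.
apply: le_trans (metric_triangle x y a).
by apply: ge_inf => //; right; exists a.
Qed.

Lemma setdist_in A x : A x -> setdist A x = 0.
Proof.
move=> Ax; apply/eqP; rewrite eq_le setdist_ge0 andbT.
by apply: ge_inf => //; right; exists x => //; exact: mdistxx.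
Qed.

Lemma setdist_continuous A : continuous (setdist A).
Proof.
move=> x; apply/cvgrPdist_le => e e0.
have xe : \forall y \near x, mdist x y < e.
  by apply/metricType_numDomainType.nbhs_mdistP; exists e.
near=> y; have xy : mdist x y < e by near: y.
rewrite ler_norml lerBrDr addrC lerBlDr !lerBlDr; apply/andP; split.
- by rewrite (le_trans (setdist_lipschitz A y x))// addrC lerD2l metric_sym ltW.
- by rewrite (le_trans (setdist_lipschitz A x y))// lerD2r ltW.
Unshelve. all: by end_near. Qed.

Lemma setdist_gt0 A x : closed A -> ~ A x -> 0 < setdist A x.
Proof.
move=> cA nAx; have : nbhs x (~` A).
  by apply: open_nbhs_nbhs; split; first exact: closed_openC.
move=> /(metricType_numDomainType.nbhs_mdistP x (~` A))[e /= e0 eA].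
rewrite (@lt_le_trans _ _ (Num.min 1 e))// ?lt_min ?ltr01//.
apply: lb_le_inf => // _ [->|[a Aa <-]]; rewrite ge_min ?lexx//.
by apply/orP; right; rewrite leNgt; apply/negP => /eA; exact.
Qed.

Lemma open_setdist_lt A r : open [set x | setdist A x < r].
Proof.
apply: (@open_comp _ _ (setdist A) [set y | y < r]); last exact: open_lt.
by move=> x _; exact: setdist_continuous.
Qed.

(** The [P k] form a filter base, and a cluster point of it lies in every closure. The limit
    arguments below use this in place of convergent subsequences. *)
Lemma compact_decreasing_cluster K (P : nat -> set X) : compact K ->
  (forall k, P k !=set0) -> (forall k, P k `<=` K) ->
  (forall m k, (m <= k)%N -> P k `<=` P m) ->
  exists2 y, K y & forall k A, nbhs y A -> P k `&` A !=set0.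
Proof.
move=> cK P0 PK Pdecr.
have FF : ProperFilter (filter_from setT P).
  apply: filter_from_proper; last by move=> k _; exact: P0.
  apply: filter_from_filter; first by exists 0%N.
  move=> i j _ _; exists (maxn i j) => // y Py.
  by split; apply: Pdecr Py; rewrite (leq_maxl, leq_maxr).
have /(cK _ FF)[y [Ky yP]] : filter_from setT P K by exists 0%N.
by exists y => // k A yA; apply: yP => //; exists k.
Qed.

End metric_space.

(** * Orbits, invariant sets and limit sets of a flow *)

Section flow.
Context {R : realType} {X : metricType R} (phi : R -> X -> X).
Hypothesis flow_phi : is_flow phi.
Implicit Types (A C I K S : set X) (x y : X) (s t : R).

Lemma flow_continuous2 (z : R * X) :
  {for z, continuous (fun z : R * X => phi z.1 z.2)}.
Proof. by case: flow_phi => c _ _; exact: c. Qed.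

Lemma flow0 x : phi 0 x = x.
Proof. by case: flow_phi. Qed.

Lemma flowD s t x : phi (s + t) x = phi s (phi t x).
Proof. by case: flow_phi. Qed.

Lemma flow_continuous t : continuous (phi t).
Proof.
move=> x; apply: (@continuous_comp _ _ _ (fun y => (t, y))
  (fun z : R * X => phi z.1 z.2)).
  by apply: continuous_at_pair; [exact: cst_continuous|exact: cvg_id].
exact: flow_continuous2.
Qed.

Lemma flow_time_continuous x : continuous (phi^~ x).
Proof.
move=> t; apply: (@continuous_comp _ _ _ (fun s => (s, x))
  (fun z : R * X => phi z.1 z.2)).
  by apply: continuous_at_pair; [exact: cvg_id|exact: cst_continuous].
exact: flow_continuous2.
Qed.

Lemma invariant_setP S :
  invariant_set phi S <-> forall t x, S x -> S (phi t x).
Proof.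
split=> [iS t x Sx|iS t]; first by rewrite -(iS t); exists x.
apply/seteqP; split=> [_ [x Sx <-]|x Sx]; first exact: iS.
by exists (phi (- t) x); [exact: iS|rewrite -flowD subrr flow0].
Qed.

Lemma closure_invariant S :
  invariant_set phi S -> invariant_set phi (closure S).
Proof.
move=> /invariant_setP iS; apply/invariant_setP => t x Sx B.
move=> /(flow_continuous (x := x))/Sx[y [Sy By]].
by exists (phi t y); split => //; exact: iS.
Qed.

(** The closure of [I] is invariant and stays in the closed [K], so maximality puts it inside
    [I]. *)
Lemma isolated_invariant_closed I : isolated_invariant phi I -> closed I.
Proof.
move=> [K [cK _ [IK iI maxI]]]; apply: maxI; last exact: closure_invariant.
have /closure_id -> : closed K.
  by apply: compact_closed => //; exact: metric_hausdorff.
exact: closureS.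
Qed.

Lemma maximal_invariant_orbit K I y : maximal_invariant phi K I ->
  (forall t, K (phi t y)) -> I y.
Proof.
move=> [_ _ maxI] Ky; apply: (maxI (range (phi^~ y))).
- by move=> _ [t _ <-].
- by apply/invariant_setP => t _ [s _ <-]; exists (t + s) => //; rewrite flowD.
- by exists 0; rewrite ?flow0.
Qed.

Lemma omega_limit_meets C y : compact C ->
  (forall t, 0 <= t -> C (phi t y)) -> C `&` omega_limit phi y !=set0.
Proof.
move=> cC Cy; have CF : \forall t \near +oo, C (phi t y).
  by near=> t; apply: Cy; near: t; exact: nbhs_pinfty_ge.
exact: cC CF.
Unshelve. all: by end_near. Qed.

Lemma alpha_limit_meets C y : compact C ->
  (forall t, t < 0 -> C (phi t y)) -> C `&` alpha_limit phi y !=set0.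
Proof.
move=> cC Cy; have CF : \forall t \near -oo, C (phi t y).
  by near=> t; apply: Cy; near: t; exact: nbhs_ninfty_lt.
exact: cC CF.
Unshelve. all: by end_near. Qed.

(** Near [z] there are points [phi s y] with [s <= - t]; [phi t] moves them to nonpositive times on
    the orbit of [y], hence into [C]. *)
Lemma alpha_limit_flow C y z t : closed C ->
  (forall s, s <= 0 -> C (phi s y)) -> alpha_limit phi y z -> C (phi t z).
Proof.
move=> cC Cy yz; rewrite (closure_id C).1//.
move=> B /(flow_continuous (x := z)) zB.
have : \forall s \near -oo, [set phi s y | s in [set s | s <= - t]] (phi s y).
  near=> s; exists s => //=; near: s; exact: nbhs_ninfty_le.
move=> /yz/(_ zB)[_ [[s /= st <-] Bs]].
exists (phi t (phi s y)); split => //.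
by rewrite -flowD; apply: Cy; rewrite addrC -lerBrDr sub0r.
Unshelve. all: by end_near. Qed.

(** The distance to [A] is positive along the orbit of [y]; compactness of the time window makes the
    bound uniform, also for nearby points. *)
Lemma setdist_flow_away A y T : closed A -> (forall t, ~ A (phi t y)) ->
  exists k : nat, \forall y' \near y, forall t, -T <= t <= T ->
    k.+1%:R^-1 <= setdist A (phi t y').
Proof.
move=> cA Ay.
have /compact_near_coveringP cT := @segment_compact R (- T) T.
have : \forall z \near filter_prod (nbhs y) \oo,
    `[- T, T] `<=` (fun t => (z.2 : nat).+1%:R^-1 <= setdist A (phi t z.1)).
  apply: cT => t _.
  have e0 : 0 < setdist A (phi t y) / 2 by rewrite divr_gt0// setdist_gt0.
  have : \forall t' \near t & y' \near y,
      setdist A (phi t y) / 2 < setdist A (phi t' y').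
    have c : {for (t, y),
        continuous (fun z : R * X => setdist A (phi z.1 z.2))}.
      apply: continuous_comp; first exact: flow_continuous2.
      exact: setdist_continuous.
    apply: (cvgr_gt (setdist A (phi t y)) c).
    by rewrite ltr_pdivrMr// ltr_pMr ?ltr1n// setdist_gt0.
  move=> [[/= U V] [tU yV] UV].
  exists (U, [set z | V z.1 /\ (z.2 : nat).+1%:R^-1 < setdist A (phi t y) / 2]).
    split => //=.
    exists (V, [set k : nat | k.+1%:R^-1 < setdist A (phi t y) / 2]).
      split => //=; exact: near_infty_natSinv_lt (PosNum e0).
    by move=> [y' k].
  move=> [t' [y' k]] /= [Ut' [Vy' kd]].
  by apply/ltW/(lt_trans kd); exact: (UV (t', y')).
move=> [[/= U V] [yU [N _ NV]] UV]; exists N.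
apply: filterS yU => y' Uy' t tT; apply: (UV (y', N)) => /=.
  by split=> //; apply: NV => /=.
by rewrite /= in_itv.
Qed.

End flow.

(** * Orbit segments near a Morse decomposition *)

Section morse.
Context {R : realType} {X : metricType R} (phi : R -> X -> X).
Context (I K : set X) (n : nat) (M : 'I_n -> set X).
Hypothesis flow_phi : is_flow phi.
Hypothesis cK : compact K.
Hypothesis maxI : maximal_invariant phi K I.
Hypothesis morseM : morse_decomposition phi I M.
Implicit Types (A C P : set X) (x y : X) (r s t u : R) (k : nat).

Let closedK : closed K.
Proof. by apply: compact_closed => //; exact: metric_hausdorff. Qed.

Let M_closed i : closed (M i).
Proof.
by case: morseM => _ /(_ i)[/(isolated_invariant_closed flow_phi)].
Qed.

Let M_flow i t y : M i y -> M i (phi t y).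
Proof.
case: morseM => _ /(_ i)[[? [_ _ [_ iM _]]] _] _.
by move/(invariant_setP flow_phi): iM; exact.
Qed.

Let M_flowP i t y : M i (phi t y) -> M i y.
Proof.
by move=> /(M_flow (- t)); rewrite -flowD// addNr flow0.
Qed.

Let M_disjoint i j y : M i y -> M j y -> i = j.
Proof. by case: morseM => tM _ _ Mi Mj; apply: tM => //; exists y. Qed.

Let closure_flow C P y t : closed C -> closure P y ->
  (forall z, P z -> C (phi t z)) -> C (phi t y).
Proof.
move=> cC Py PC; rewrite (closure_id C).1// => B.
move=> /(flow_continuous flow_phi (x := y))/Py[z [Pz Bz]].
by exists (phi t z); split => //; exact: PC.
Qed.

Let closureI_nbhs P A y : closure P y -> nbhs y A -> closure (P `&` A) y.
Proof.
by move=> Py yA B yB; rewrite -setIA; apply: Py; exact: filterI.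
Qed.

(* Otherwise arbitrarily long segments avoid all the V i; their endpoints
   accumulate at some y, and alpha(y) contains a full orbit in I avoiding all
   the V i. *)
Lemma morse_capture (V : 'I_n -> set X) :
  (forall i, open (V i)) -> (forall i, M i `<=` V i) ->
  exists2 T, 0 <= T & forall x, (forall s, 0 <= s <= T -> K (phi s x)) ->
    exists2 s, 0 <= s <= T & exists i, V i (phi s x).
Proof.
move=> oV MV; apply: contrapT => /forall2NP noT.
pose C := K `\` \bigcup_i V i.
have closedC : closed C.
  by apply: closedI => //; apply: open_closedC; exact: bigcup_open.
have cC : compact C.
  by apply: (subclosed_compact closedC cK) => x [].
pose P k := [set y | forall s, - k%:R <= s <= 0 -> C (phi s y)].
have [|k y Py|m k mk y Py s /andP[ms s0]|y Cy Py] :=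
  compact_decreasing_cluster (P := P) cC.
- move=> k; have [[]|] := noT k%:R; first exact: ler0n.
  move=> /existsNP[x /not_implyP[Kx /forall2NP nV]].
  exists (phi k%:R x) => s /andP[ks s0]; rewrite -flowD//.
  have sk : 0 <= s + k%:R <= k%:R by rewrite -lerBlDr sub0r ks gerDr.
  split; first exact: Kx.
  by move=> [i _ Vi]; have [/(_ sk)|] := nV (s + k%:R) => //; apply; exists i.
- by rewrite -(flow0 flow_phi y); apply: Py; rewrite lexx oppr_le0 ler0n.
- by apply: Py; rewrite s0 (le_trans _ ms)// lerN2 ler_nat.
have {Py}Cy s : s <= 0 -> C (phi s y).
  move=> s0.
  apply: (closure_flow closedC (Py (Num.truncn (- s)).+1)) => z; apply.
  by rewrite s0 lerNl ltW// truncnS_gt.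
have [|z [Cz yz]] := @alpha_limit_meets _ _ phi C y cC.
  by move=> s /ltW; exact: Cy.
have Czt t : C (phi t z) by exact: alpha_limit_flow yz.
have Iz : I z.
  by apply: (maximal_invariant_orbit flow_phi maxI) => t; have [] := Czt t.
have MC w i : M i w -> C w -> False by move=> /MV Vi [_]; apply; exists i.
have [[i _ /MC]|nMz] := pselect ((\bigcup_i M i) z); first exact.
(* The omega-limit of [z] lies in some [M j], yet it meets [C], which avoids [V j]. *)
case: morseM => _ _ /(_ z (conj Iz nMz))[i [j [_ _ zMj]]].
have [w [Cw /zMj /MC]] := @omega_limit_meets _ _ phi _ z cC (fun t _ => Czt t).
exact.
Qed.

(** * Segments with both ends near a Morse set *)

Section no_return.
(** The closed [C i] keeps limits of points of [O i] away from the Morse sets other than [M i]. *)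
Variables O C : 'I_n -> set X.
Hypothesis oO : forall i, open (O i).
Hypothesis MO : forall i, M i `<=` O i.
Hypothesis closedC : forall i, closed (C i).
Hypothesis OC : forall i, O i `<=` C i.
Hypothesis CM : forall i j x, C i x -> M j x -> i = j.

(* An orbit segment in K, close to M i at time - s and to M j at time u, whose
   first exit from O i is at y. *)
Let exit_point i j k y := exists s u,
  [/\ 0 <= s, 0 <= u, ~ O i y,
      forall r, - s <= r <= u -> K (phi r y) /\ (r < 0 -> O i (phi r y)) &
      setdist (M i) (phi (- s) y) < k.+1%:R^-1 /\
      setdist (M j) (phi u y) < k.+1%:R^-1].

(** A limit form of a chain of connecting orbits from [M i] to [M j] that leaves [O i]. *)
Let linked i j := forall k, exists y, exit_point i j k y.

(** The times in [[0, t]] spent outside [O i] form a nonempty compact set, whose minimum is the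
    first exit. *)
Let exit_point_first i j k x t r : 0 <= r <= t ->
  (forall s, 0 <= s <= t -> K (phi s x)) ->
  setdist (M i) x < k.+1%:R^-1 -> setdist (M j) (phi t x) < k.+1%:R^-1 ->
  ~ O i (phi r x) -> exists y, exit_point i j k y.
Proof.
move=> rt Kx xi tj nOr.
pose S := [set s | 0 <= s <= t /\ ~ O i (phi s x)].
have cS : compact S.
  have -> : S = `[0, t] `&` (phi^~ x) @^-1` (~` O i).
    by apply/seteqP; split=> s; rewrite /S /= in_itv.
  apply: (subclosed_compact _ (@segment_compact R 0 t)); last by move=> s [].
  apply: closedI; first exact: itv_closed.
  apply: closed_comp; last exact: open_closedC.
  by move=> s _; exact: flow_time_continuous.
have S0 : S !=set0 by exists r.
have cid : {within S, continuous (idfun : R -> R)}.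
  by apply: continuous_subspaceT => ?; exact: cvg_id.
have [s] := compact_EVT_min S0 cS cid; rewrite inE => -[/andP[s0 st] nOs] smin.
exists (phi s x), s, (t - s); split => //.
- by rewrite subr_ge0.
- move=> q /andP[sq qt]; rewrite -flowD//; split.
    by apply: Kx; rewrite -lerBlDr sub0r sq -lerBrDr.
  move=> q0; apply: contrapT => nOq.
  have : q + s \in S.
    rewrite inE; split=> //; rewrite -lerBlDr sub0r sq/=.
    by rewrite (le_trans _ st)// gerDr ltW.
  by move=> /smin /=; rewrite lerDr leNgt q0.
- by rewrite -!flowD// addNr subrK flow0.
Qed.

Let exit_point_le i j m k :
  (m <= k)%N -> exit_point i j k `<=` exit_point i j m.
Proof.
move=> mk y [s [u [s0 u0 nO KOy [si uj]]]]; exists s, u; split=> //.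
have km : k.+1%:R^-1 <= m.+1%:R^-1 :> R by rewrite lef_pV2 ?posrE// ler_nat.
by split; [exact: lt_le_trans km|exact: lt_le_trans km].
Qed.

(** Otherwise points of [C i] approaching [M j] would accumulate at a point of both. *)
Let M_separated i j : i != j ->
  exists k, forall x, K x -> setdist (M j) x < k.+1%:R^-1 -> ~ O i x.
Proof.
move=> ij; apply: contrapT => /forallNP nk.
pose P k := [set x | [/\ K x, C i x & setdist (M j) x <= k.+1%:R^-1]].
have [k|k x []//|m k mk x [Kx Cx xk]|y _ Py] :=
  compact_decreasing_cluster (P := P) cK.
- have /existsNP[x /not_implyP[Kx /not_implyP[xk /contrapT /OC Cx]]] := nk k.
  by exists x; split=> //; exact: ltW.
- by split=> //; rewrite (le_trans xk)// lef_pV2 ?posrE// ler_nat.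
have cl k : C i y /\ setdist (M j) y <= k.+1%:R^-1.
  suff : (C i `&` [set x | setdist (M j) x <= k.+1%:R^-1]) (phi 0 y).
    by rewrite flow0.
  apply: closure_flow (Py k) _; last by move=> z []; rewrite flow0.
  apply: closedI => //.
  apply: (@closed_comp _ _ (setdist (M j)) [set r | r <= _]).
    by move=> ? _; exact: setdist_continuous.
  exact: closed_le.
have [Cy _] := cl 0%N; move/eqP: ij; apply; apply: CM Cy _.
apply: contrapT => /(setdist_gt0 (@M_closed j)) jy.
have [N _ /(_ _ (leqnn N))/=] := near_infty_natSinv_lt (PosNum jy).
by rewrite ltNge (cl N).2.
Qed.

(* A limit y of exit points is a point of I whose alpha-limit is in M i; its
   omega-limit lies in some M l with i < l, and l = j or again linked l j. *)
Let linked_lt i j : linked i j -> (i < j)%N.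
Proof.
(* Induction on [n - i], which drops when [i] is replaced by a larger [l]. *)
have [m] := ubnP (n - i)%N; elim: m i => // m IH i nim lij.
have [|k y [s [u [s0 u0 _ Ky _]]]||y Ky Py] :=
  compact_decreasing_cluster (P := exit_point i j) cK.
- exact: lij.
- by rewrite -(flow0 flow_phi y); apply: (Ky 0 _).1; rewrite oppr_le0 s0.
- exact: exit_point_le.
have nOy : ~ O i y.
  rewrite -(flow0 flow_phi y).
  apply: (closure_flow (open_closedC (oO i)) (Py 0%N)) => z.
  by rewrite flow0// => -[s [u []]].
have nMi t : ~ M i (phi t y) by move=> /M_flowP /MO.
have away l T : (forall t, ~ M l (phi t y)) -> exists k, \forall z \near y,
    forall t, - T <= t <= T -> k.+1%:R^-1 <= setdist (M l) (phi t z).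
  by move=> nMl; exact: setdist_flow_away.
(* The orbit of [y] avoids [M i], so points near [y] stay away from [M i] during [[t, - t]]. Exit
   points of large index near [y] thus started no later than [t], and were in [O i] at time [t]. *)
have back t : t < 0 -> K (phi t y) /\ C i (phi t y).
  move=> t0; have [k kP] := away i (- t) nMi.
  have cKC : closed (K `&` C i) by exact: closedI.
  apply: (closure_flow cKC (closureI_nbhs (Py k) kP)) => z.
  move=> [[s [u [s0 u0 _ Kz [si _]]]] zP].
  have st : - s <= t.
    rewrite leNgt; apply/negP => ts; move: si; apply/negP; rewrite -leNgt.
    apply: zP; rewrite opprK (ltW ts)/=.
    by rewrite (le_trans _ (_ : 0 <= - t)) ?oppr_le0// oppr_ge0 ltW.
  have [|Kt /(_ t0)/OC] := Kz t; last by [].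
  by rewrite st (le_trans (ltW t0)).
have nMj t : ~ M j (phi t y).
  move=> Mj; have [_ Ci] := back (- 1) (ltrN10 _).
  have ij : i = j by apply: CM Ci _; apply: M_flow; exact: M_flowP Mj.
  by apply: (nMi t); rewrite ij.
(* Likewise at the other end: points near [y] can get close to [M j] at a nonnegative time only
   after [t]. *)
have long t : 0 <= t -> exists k, \forall z \near y,
    forall s u, - s <= u -> setdist (M j) (phi u z) < k.+1%:R^-1 ->
      0 <= u -> t < u.
  move=> t0; have [k kP] := away j t nMj; exists k.
  apply: filterS kP => z zP s u su uj u0.
  rewrite ltNge; apply/negP => ut; move: uj; apply/negP; rewrite -leNgt.
  by apply: zP; rewrite ut andbT (le_trans _ u0)// oppr_le0.
have Kt t : K (phi t y).
  have [/back[]//|t0] := ltP t 0.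
  have [k kP] := long t t0.
  apply: (closure_flow closedK (closureI_nbhs (Py k) kP)) => z.
  move=> [[s [u [s0 u0 _ Kz [_ uj]]]] zP].
  apply: (Kz t _).1; rewrite (le_trans _ t0) ?oppr_le0//=.
  by apply/ltW/(zP s) => //; rewrite (le_trans _ u0) ?oppr_le0.
have Iy : I y by exact: (maximal_invariant_orbit flow_phi maxI).
have nMy : ~ (\bigcup_l M l) y.
  move=> [l _ Ml]; have [_ Ci] := back (- 1) (ltrN10 _).
  have il : i = l by apply: CM Ci _; exact: M_flow.
  by apply: (nMi 0); rewrite flow0// il.
case: morseM => _ _ /(_ y (conj Iy nMy))[a [l [al yMa yMl]]].
(* The backward orbit stays in the compact [K] and [C i], so the alpha-limit meets [C i]. *)
have ai : i = a.
  have cKC : compact (K `&` C i).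
    by apply: (subclosed_compact _ cK); [exact: closedI|move=> ? []].
  have [w [[_ Cw] /yMa Mw]] := alpha_limit_meets cKC back.
  exact: CM Cw Mw.
rewrite -ai in al.
have [<-//|lj] := eqVneq l j.
apply: (ltn_trans al); apply: IH.
  move: nim; rewrite ltnS; apply: leq_trans.
  by apply: ltn_sub2l => //; exact: ltn_ord.
(* Exit points near [y] follow its orbit until close to [M l] and end close to [M j]; the piece in
   between witnesses [linked l j]. *)
move=> k.
have [w [_ yw]] := @omega_limit_meets _ _ phi _ y cK (fun t _ => Kt t).
have [t [t0 tl]] : exists t, 0 <= t /\ setdist (M l) (phi t y) < k.+1%:R^-1.
  have [||_ [[t /= t0 <-] tl]] := yw [set phi t y | t in [set t | 0 <= t]]
    [set z | setdist (M l) z < k.+1%:R^-1].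
  - have : \forall t \near +oo, [set phi t y | t in [set t | 0 <= t]] (phi t y).
      by near=> t; exists t => //=; near: t; exact: nbhs_pinfty_ge.
    exact.
  - apply: open_nbhs_nbhs; split; first exact: open_setdist_lt.
    by rewrite /= setdist_in ?invr_gt0//; exact: yMl.
  by exists t.
have tlz : \forall z \near y, setdist (M l) (phi t z) < k.+1%:R^-1.
  have : nbhs (phi t y) [set z | setdist (M l) z < k.+1%:R^-1].
    by apply: open_nbhs_nbhs; split; first exact: open_setdist_lt.
  exact: (flow_continuous flow_phi (x := y)).
have [k0 k0P] := long t t0.
have [k1 k1P] := M_separated lj.
(* [k] is the closeness asked for, [k0] makes the arrival near [M j] later than [t], and [k1] puts
   that arrival outside [O l]. *)
pose p := maxn k (maxn k0 k1).
have [z [[s [u [s0 u0 _ Kz [_ uj]]]] [zl zP]]] := Py p _ (filterI tlz k0P).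
have kp q : (q <= p)%N -> setdist (M j) (phi u z) < q.+1%:R^-1.
  by move=> qp; rewrite (lt_le_trans uj)// lef_pV2 ?posrE// ler_nat.
have su : - s <= u by rewrite (le_trans _ u0) ?oppr_le0.
have tu : t < u.
  apply: (zP s u su _ u0); apply: kp.
  by rewrite /p !leq_max leqnn orbT.
have Ku : K (phi u z) by apply: (Kz u _).1; rewrite su lexx.
apply: (@exit_point_first l j k (phi t z) (u - t) (u - t)) => //.
- by rewrite lexx subr_ge0 ltW.
- move=> r /andP[r0 ru]; rewrite -flowD//; apply: (Kz _ _).1.
  by rewrite -lerBrDr ru (le_trans _ (addr_ge0 r0 t0)) ?oppr_le0.
- by rewrite -flowD// subrK; apply: kp; rewrite leq_maxl.
- rewrite -flowD// subrK; apply: k1P => //; apply: kp.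
  by rewrite /p !leq_max leqnn !orbT.
Unshelve. all: by end_near. Qed.

(** [linked i i] would give [i < i], so for some [k] there is no exit point; this [k] sets the size
    of [V]. *)
Lemma no_return_of_separated i : exists V, [/\ open V, M i `<=` V &
  forall x t, 0 <= t -> (forall s, 0 <= s <= t -> K (phi s x)) ->
    V x -> V (phi t x) -> forall s, 0 <= s <= t -> O i (phi s x)].
Proof.
have : ~ linked i i by move=> /linked_lt; rewrite ltnn.
move=> /existsNP[k nk]; exists [set x | setdist (M i) x < k.+1%:R^-1]; split.
- exact: open_setdist_lt.
- by move=> x Mx; rewrite /= setdist_in.
- move=> x t t0 Kx xi ti s st; apply: contrapT => nO; apply: nk.
  exact: exit_point_first st Kx xi ti nO.
Qed.

End no_return.

Lemma morse_no_return (O : 'I_n -> set X) i : (forall i, open (O i)) ->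
  (forall i, M i `<=` O i) -> exists V, [/\ open V, M i `<=` V &
  forall x t, 0 <= t -> (forall s, 0 <= s <= t -> K (phi s x)) ->
    V x -> V (phi t x) -> forall s, 0 <= s <= t -> O i (phi s x)].
Proof.
move=> oO MO; pose F i := \bigcup_(j in [set j | j != i]) M j.
have cF j : closed (F j).
  by apply: closed_bigcup => [|l _]; [exact: finite_finset|exact: M_closed].
have cd A : continuous (setdist A) by exact: setdist_continuous.
(* [O' j] keeps the points nearer to [M j] than to the other Morse sets; [C j] allows equality. If
   there are no others, the cap in [setdist] gives the empty [F j] distance 1. *)
pose O' j := O j `&` [set x | 0 < setdist (F j) x - setdist (M j) x].
pose C j := [set x | 0 <= setdist (F j) x - setdist (M j) x].
have cdB j : continuous (fun x => setdist (F j) x - setdist (M j) x).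
  by move=> x; apply: cvgB; exact: cd.
have [||||j l x|V [oV MV VO]] := @no_return_of_separated O' C _ _ _ _ _ i.
- move=> j; apply: openI => //.
  apply: (@open_comp _ _ (fun x => setdist (F j) x - setdist (M j) x)
    [set r | 0 < r]); last exact: open_gt.
  by move=> ? _; exact: cdB.
- move=> j x Mx; split; first exact: MO.
  rewrite /= [setdist (M j) x]setdist_in// subr0; apply: setdist_gt0 => //.
  by move=> [l /= /eqP lj Ml]; apply: lj; exact: M_disjoint Ml Mx.
- move=> j; apply: (@closed_comp _ _ (fun x => setdist (F j) x - setdist (M j) x)
    [set r | 0 <= r]); last exact: closed_ge.
  by move=> ? _; exact: cdB.
- by move=> j x [_ /ltW].
- rewrite /C /= => Cx Ml; apply/eqP; apply: contraPT isT => jl _.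
  (* [x] is at distance 0 from [F j], hence from the closed [M j]. *)
  have : M j x.
    apply: contrapT => /(setdist_gt0 (@M_closed j)).
    apply/negP; rewrite -leNgt; move: Cx.
    rewrite [setdist (F j) x]setdist_in ?sub0r ?oppr_ge0//.
    by exists l => //=; rewrite eq_sym.
  by move=> /M_disjoint/(_ Ml)/eqP; apply/negP.
exists V; split=> // x t t0 Kx Vx Vt s st.
by have [] := VO x t t0 Kx Vx Vt s st.
Qed.

End morse.

(** * Auxiliary facts on continuity, weighted means and compactness *)

Lemma continuous_within_comp {S T U : topologicalType} (A : set T) (g : S -> T)
    (f : T -> U) : (forall y, A (g y)) -> {within A, continuous f} ->
  continuous g -> continuous (f \o g).
Proof.
move=> gA /subspace_continuousP fA cg y W /(fA _ (gA y)) /cg.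
by rewrite !nbhs_simpl /=; apply: filterS => z; apply; exact: gA.
Qed.

Lemma continuous_big_sum {R : realType} {T : topologicalType} {J : Type}
    (js : seq J) (f : J -> T -> R) : (forall j, continuous (f j)) ->
  continuous (fun q => \sum_(j <- js) f j q).
Proof.
move=> cf; elim: js => [|j js IH] q.
  by under eq_fun do rewrite big_nil; exact: cst_continuous.
under eq_fun do rewrite big_cons.
exact: cvgD (cf j q) (IH q).
Qed.

(** The deviations from the mean have weighted sum 0, so those of positive weight cannot all have
    the same strict sign. In [key], [c] is 1 or -1 to give both bounds. *)
Lemma weighted_mean_bounds {R : realFieldType} {J : eqType} (js : seq J)
    (f w : J -> R) : (forall j, 0 <= w j) -> 0 < \sum_(j <- js) w j ->
  let m := (\sum_(j <- js) f j * w j) / \sum_(j <- js) w j in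
  exists a b, [/\ 0 < w a, 0 < w b & f a <= m <= f b].
Proof.
move=> w0 W0 m.
have sum0 : \sum_(j <- js) (f j - m) * w j = 0.
  under eq_bigr do rewrite mulrBl.
  by rewrite sumrB -mulr_sumr divfK ?subrr// gt_eqF.
have key (c : R) : c != 0 ->
    exists2 j, j \in js & (0 < w j) && (0 <= c * (m - f j)).
  move=> c0; apply/hasP; apply: contraLR W0 => /hasPn nj.
  rewrite -leNgt big_seq big1// => j jjs.
  have ge0 i : i \in js -> 0 <= c * ((f i - m) * w i).
    move=> /nj; rewrite negb_and -leNgt -ltNge => /orP[wi|ci].
      by rewrite (@le_anti _ _ (w i) 0) ?wi ?w0// !mulr0.
    by rewrite mulrA mulr_ge0// -opprB mulrN oppr_ge0 ltW.
  have : \sum_(i <- js) c * ((f i - m) * w i) == 0.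
    by rewrite -mulr_sumr sum0 mulr0.
  rewrite big_seq psumr_eq0// => /allP /(_ j jjs) /implyP /(_ jjs).
  rewrite !mulf_eq0 (negbTE c0)/= => /orP[|/eqP//].
  rewrite subr_eq0 => /eqP jm; move: (nj j jjs).
  rewrite jm subrr mulr0 lexx andbT -leNgt => wj.
  by apply/le_anti; rewrite wj w0.
have [a _ /andP[wa]] := key 1 (oner_neq0 _).
rewrite mul1r subr_ge0 => am.
have [|b _ /andP[wb]] := key (-1); first by rewrite oppr_eq0 oner_neq0.
rewrite mulN1r opprB subr_ge0 => mb.
by exists a, b; split=> //; rewrite am.
Qed.

(** Finitely many of the open sets where [f i j] exceeds some [k.+1%:R^-1] cover [K]. [js] collects
    their [j] and [e] comes from the largest [k]; nonnegativity bounds the sum below by one term. *)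
Lemma compact_uniform_positive {R : realType} {T : ptopologicalType} {n : nat}
    {J : choiceType} (K : set T) (f : 'I_n -> J -> T -> R) : compact K ->
  (forall i j, continuous (f i j)) -> (forall i j q, 0 <= f i j q) ->
  (forall q, K q -> exists i j, 0 < f i j q) ->
  exists js (e : R), 0 < e /\
    forall q, K q -> exists i, e <= \sum_(j <- js) f i j q.
Proof.
rewrite compact_cover => cK cf f0 fK.
have [|q|F _ KF] := cK _ [set: 'I_n * J * nat]
  (fun p => [set q | p.2.+1%:R^-1 < f p.1.1 p.1.2 q]).
- move=> p _; apply: (@open_comp _ _ (f p.1.1 p.1.2) [set r | _ < r]).
    by move=> q _; exact: cf.
  exact: open_gt.
- move=> /fK[i [j fq]].
  have [k _ /(_ _ (leqnn k))/= kq] := near_infty_natSinv_lt (PosNum fq).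
  by exists (i, j, k).
exists [seq p.1.2 | p <- finmap.enum_fset F],
  (\max_(p <- finmap.enum_fset F) p.2).+1%:R^-1.
split=> [|q /KF[[[i j] k] /= pF fq]]; first by rewrite invr_gt0.
exists i; rewrite big_map (@le_trans _ _ (k.+1%:R^-1))//.
  by rewrite lef_pV2 ?posrE// ler_nat ltnS; exact: (leq_bigmax_seq _ pF).
by rewrite (big_rem (i, j, k))//= (le_trans (ltW fq))// lerDl sumr_ge0.
Qed.

(** * The quotient, its semi-flow and deformations along it *)

Section quotient.
Context {R : realType} {X : topologicalType} (N L : set X).
Implicit Types (x : X) (q : pquot N L).

Lemma collapse_notin x : ~ (N `\` L) x -> collapse N L x = None.
Proof.
by move=> nx; rewrite /collapse insubF//; apply/negbTE/negP; rewrite inE.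
Qed.

Lemma collapse_in x : (N `\` L) x ->
  exists2 y : set_type (N `\` L), val y = x & collapse N L x = Some y.
Proof.
by move=> Dx; rewrite /collapse; case: insubP => [y _ <-|/negP[]];
  [exists y|rewrite inE].
Qed.

Lemma collapse_val (y : set_type (N `\` L)) : collapse N L (val y) = Some y.
Proof. exact: valK. Qed.

Lemma pquot_cases q : q = None \/ exists2 x, (N `\` L) x & q = collapse N L x.
Proof.
case: q => [y|]; last by left.
by right; exists (val y); [exact: set_valP|rewrite collapse_val].
Qed.

Lemma collapse_continuous : {within N, continuous (collapse N L)}.
Proof. by apply/subspace_sigL_continuousP/continuousP => U. Qed.

Lemma pquot_continuous {T : topologicalType} (f : pquot N L -> T) :
  {within N, continuous (f \o collapse N L)} -> continuous f.
Proof.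
by move=> /subspace_sigL_continuousP/continuousP cf; apply/continuousP => U /cf.
Qed.

Lemma pquot_open_preimage (U : set (pquot N L)) : open U ->
  exists2 W, open W & forall x, N x -> W x <-> U (collapse N L x).
Proof.
move=> [W oW WU]; exists W => // x Nx.
have : (set_val @^-1` W) (SigSub (mem_set Nx)) = U (collapse N L x).
  by rewrite WU.
by move=> /= ->.
Qed.

Lemma pquot_base_indicator_continuous : L = set0 ->
  continuous (fun q : pquot N L => (if q is Some _ then 1 else 0) : R).
Proof.
move=> L0; apply: pquot_continuous.
have : {within N, continuous (fun=> 1 : R)}.
  by apply: continuous_subspaceT; exact: cst_continuous.
apply: subspace_eq_continuous => y /set_mem Ny.
have [|z _ yz] := @collapse_in y; first by rewrite L0 setD0.
by rewrite /from_subspace /= yz.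
Qed.

Lemma pquot_open_base : L = set0 -> open [set None : pquot N L].
Proof.
move=> L0.
have -> : [set None : pquot N L] =
    (fun q : pquot N L => (if q is Some _ then 1 else 0) : R)
      @^-1` [set r | r < 1].
  by apply/seteqP; split=> [_ ->|[y|]]//=; rewrite ?ltr01 ?ltxx.
apply: open_comp; last exact: open_lt.
by move=> q _; exact: pquot_base_indicator_continuous.
Qed.

Lemma pquot_compact : compact N -> compact [set: pquot N L].
Proof.
(* The base point is added by hand, as [collapse] misses it when [L] is empty. *)
move=> cN; have -> : [set: pquot N L] = collapse N L @` N `|` [set None].
  apply/seteqP; split=> // q _; have [->|[x [Nx _] ->]] := pquot_cases q.
    by right.
  by left; exists x.
apply: compactU; last exact: compact_set1.
by apply: continuous_compact => //; exact: collapse_continuous.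
Qed.

Section semiflow.
Variable phi : R -> X -> X.
Hypothesis phi0 : forall x, phi 0 x = x.
Hypothesis semiflow_continuous : {within [set z : R * pquot N L | 0 <= z.1],
  continuous (fun z : R * pquot N L => induced_semiflow phi z.1 z.2)}.
Notation Phi := (induced_semiflow phi).

Lemma semiflow_collapse t x : 0 <= t ->
  (forall s, 0 <= s <= t -> (N `\` L) (phi s x)) ->
  Phi t (collapse N L x) = collapse N L (phi t x).
Proof.
move=> t0 Dx.
have [|y yx ->] := @collapse_in x.
  by rewrite -(phi0 x); apply: Dx; rewrite lexx.
by rewrite /= yx; case: asboolP.
Qed.

Lemma semiflow_neq_base t q : 0 <= t -> Phi t q <> None ->
  exists2 x, q = collapse N L x &
    forall s, 0 <= s <= t -> (N `\` L) (phi s x).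
Proof.
move=> t0; case: q => //= y; case: asboolP => // Dy _.
by exists (val y); rewrite ?collapse_val.
Qed.

Lemma semiflow0 q : Phi 0 q = q.
Proof.
have [->//|[x Dx ->]] := pquot_cases q.
rewrite semiflow_collapse ?phi0// => s s0.
by rewrite -(le_anti s0) phi0.
Qed.

Lemma semiflow_time_continuous (tau : pquot N L -> R) :
  (forall q, 0 <= tau q) -> continuous tau ->
  continuous (fun q => Phi (tau q) q).
Proof.
move=> tau0 ctau; apply: (continuous_within_comp _ semiflow_continuous
  (g := fun q => (tau q, q))) => // q.
by apply: continuous_at_pair; [exact: ctau|exact: cvg_id].
Qed.

Lemma semiflow_homotopic (tau : pquot N L -> R) :
  (forall q, 0 <= tau q) -> continuous tau ->
  homotopic R (fun q => Phi (tau q) q) id.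
Proof.
move=> tau0 ctau.
(* The homotopy shrinks the time from [tau] to 0. The absolute value keeps times nonnegative for
   every real parameter, so it is continuous on the whole product. *)
pose time (z : R * pquot N L) := `|(1 - z.1) * tau z.2|.
exists (fun z => Phi (time z) z.2); split; last 2 first.
- by move=> q; rewrite /time /= subr0 mul1r ger0_norm.
- by move=> q; rewrite /time /= subrr mul0r normr0 semiflow0.
apply: continuous_subspaceT.
apply: (continuous_within_comp _ semiflow_continuous
  (g := fun z => (time z, z.2))) => z /=; first exact: normr_ge0.
apply: continuous_at_pair; last exact: cvg_snd.
apply: (@cvg_norm _ _ _ (nbhs z)); apply: cvgM.
  by apply: cvgB; [exact: cvg_cst|exact: cvg_fst].
by apply: (@continuous_comp _ _ _ snd tau); [exact: cvg_snd|exact: ctau].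
Qed.

Lemma category_deform (nu : set (pquot N L) -> \bar int) (tau : pquot N L -> R)
    (A U : set (pquot N L)) : is_category R nu ->
  (forall q, 0 <= tau q) -> continuous tau ->
  (forall q, A q -> U (Phi (tau q) q)) -> (nu A <= nu U)%E.
Proof.
move=> nuC tau0 ctau AU.
apply: le_trans (category_homotopy nuC (semiflow_homotopic tau0 ctau) A) _.
by apply: (category_mono nuC) => _ [q /AU Uq <-].
Qed.

End semiflow.
End quotient.

(** The induction starts at one set: the axioms do not bound the category of the empty set by 0. *)
Lemma category_bigcup {R : realType} {T : topologicalType}
    (nu : set T -> \bar int) n (A : 'I_n -> set T) : is_category R nu ->
  (0 < n)%N -> (nu (\bigcup_i A i) <= \sum_(i < n) nu (A i))%E.
Proof.
move=> nuC; case: n A => // n A _; elim: n A => [|n IH] A.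
  rewrite big_ord1; apply: (category_mono nuC) => x [i _].
  by rewrite (ord1 i).
rewrite big_ord_recl; apply: le_trans (leeD (lexx _) (IH _)).
apply: le_trans (category_subadd nuC _ _).
apply: (category_mono nuC) => x [i _ Ai].
have [j ij|i0] := unliftP ord0 i; last by left; rewrite -i0.
by right; exists j; rewrite -?ij.
Qed.

(** * Pushing points to a time between two visits *)

Section visit.
Context {R : realType} {X : metricType R} (phi : R -> X -> X) (N L : set X).
Hypothesis flow_phi : is_flow phi.
Hypothesis cL : compact L.
Hypothesis semiflow_continuous : {within [set z : R * pquot N L | 0 <= z.1],
  continuous (fun z : R * pquot N L => induced_semiflow phi z.1 z.2)}.
Notation Phi := (induced_semiflow phi).

(* M i, hence V, may meet L: the distance to L makes this continuous at [L]. *)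
Definition visit (V : set X) (q : pquot N L) : R :=
  if q is Some y then setdist (L `|` ~` V) (val y) else 0.

Lemma visit_ge0 V q : 0 <= visit V q.
Proof. by case: q => //= y; exact: setdist_ge0. Qed.

Lemma visit_collapse V x : N x ->
  visit V (collapse N L x) = setdist (L `|` ~` V) x.
Proof.
move=> Nx; have [Lx|nLx] := pselect (L x).
  by rewrite collapse_notin => [|[]//]; rewrite setdist_in//; left.
by have [|y <- ->] := @collapse_in _ N L x.
Qed.

Lemma visit_continuous V : continuous (visit V).
Proof.
apply: pquot_continuous.
have : {within N, continuous (setdist (L `|` ~` V))}.
  by apply: continuous_subspaceT; exact: setdist_continuous.
apply: subspace_eq_continuous => x /set_mem Nx.
exact: esym (visit_collapse V Nx).
Qed.

Lemma visit_gt0 V x : open V -> (N `\` L) x -> V x ->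
  0 < visit V (collapse N L x).
Proof.
move=> oV [Nx nLx] Vx; rewrite visit_collapse//.
apply: setdist_gt0; last by move=> [].
apply: closedU; last exact: open_closedC.
by apply: compact_closed => //; exact: metric_hausdorff.
Qed.

Lemma visit_gt0_in V x : N x -> 0 < visit V (collapse N L x) -> V x.
Proof.
move=> Nx; rewrite visit_collapse//; apply: contraPP => nVx.
by rewrite setdist_in ?ltxx//; right.
Qed.

Lemma semiflow_continuous_at (t : R) :
  continuous (Phi `|t| : pquot N L -> pquot N L).
Proof.
apply: (semiflow_time_continuous semiflow_continuous (tau := fun=> `|t|)) => //.
exact: cst_continuous.
Qed.

(* The norms allow arbitrary reals as indices of nonnegative times. *)
Lemma category_visit (nu : set (pquot N L) -> \bar int) (V : set X)
    (U : set (pquot N L)) (ts : seq R) (e : R) : is_category R nu -> 0 < e ->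
  (forall x (t : R), 0 <= t ->
    (forall s : R, 0 <= s <= t -> (N `\` L) (phi s x)) ->
    V x -> V (phi t x) ->
    forall s : R, 0 <= s <= t -> U (collapse N L (phi s x))) ->
  (nu [set q | (e <= \sum_(t <- ts) visit V (Phi `|t| q))%R] <= nu U)%E.
Proof.
move=> nuC e0 stay; have phi0 := flow0 flow_phi.
pose w (t : R) q := visit V (Phi `|t| q).
have cw t : continuous (w t).
  move=> q; apply: (@continuous_comp _ _ _ (Phi `|t|) (visit V)).
    exact: semiflow_continuous_at.
  exact: visit_continuous.
(* The mean of the times weighted by the visits; the maximum with [e] keeps [tau] continuous
   everywhere and changes nothing on the set considered. *)
pose tau q := (\sum_(t <- ts) `|t| * w t q) / Num.max (\sum_(t <- ts) w t q) e.
have tau0 q : 0 <= tau q.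
  rewrite divr_ge0 ?le_max ?(ltW e0) ?orbT// sumr_ge0// => t _.
  by rewrite mulr_ge0// visit_ge0.
have ctau : continuous tau.
  have c1 : continuous (fun q => \sum_(t <- ts) `|t| * w t q).
    apply: continuous_big_sum => t q.
    apply: (@continuousM _ _ (fun=> `|t|) (w t)); last exact: cw.
    exact: cst_continuous.
  have c2 : continuous (fun q => \sum_(t <- ts) w t q).
    exact: continuous_big_sum.
  have c3 : continuous (fun q => (Num.max (\sum_(t <- ts) w t q) e)^-1).
    move=> q.
    apply: (@continuousV _ _ (fun q => Num.max (\sum_(t <- ts) w t q) e)).
      by rewrite gt_eqF// lt_max e0 orbT.
    apply: (@continuous_max _ _ (fun q => \sum_(t <- ts) w t q) (fun=> e)).
      exact: c2.
    exact: cst_continuous.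
  by move=> q; apply: (continuousM (c1 q) (c3 q)).
apply: (category_deform phi0 semiflow_continuous nuC tau0 ctau) => q /= qe.
rewrite /tau max_l//.
have [|a [b [wa wb]]] := weighted_mean_bounds (js := ts) (fun t => `|t|)
  (fun t : R => visit_ge0 V (Phi `|t| q)); first exact: lt_le_trans qe.
set m := _ / _ => /andP[am mb].
have m0 : 0 <= m by rewrite (le_trans _ am).
(* A visit at time [|b|] has positive weight, so the base point is not reached by then. *)
have [|x qx Dx] := @semiflow_neq_base _ _ _ _ phi `|b| q (normr_ge0 b).
  by move=> qb; move: wb; rewrite /= qb /= ltxx.
have Phix s : 0 <= s <= `|b| -> Phi s q = collapse N L (phi s x).
  move=> /andP[s0 sb]; rewrite qx semiflow_collapse// => r /andP[r0 rs].
  by apply: Dx; rewrite r0 (le_trans rs).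
have Vx s : 0 <= s <= `|b| -> 0 < visit V (Phi s q) -> V (phi s x).
  by move=> sb; rewrite Phix//; apply: visit_gt0_in; exact: (Dx s sb).1.
(* The segment starts at the visit at time [|a|], so that [m] falls between its two ends. *)
rewrite Phix ?m0// -[m](subrK `|a|) (flowD flow_phi).
apply: (stay _ (`|b| - `|a|)).
- by rewrite subr_ge0 (le_trans am).
- move=> s /andP[s0 sba]; rewrite -(flowD flow_phi); apply: Dx.
  by rewrite addr_ge0//= -lerBrDr.
- by apply: Vx => //; rewrite normr_ge0 (le_trans am).
- by rewrite -(flowD flow_phi) subrK; apply: Vx => //; rewrite normr_ge0 lexx.
- by rewrite subr_ge0 am lerB.
Qed.

End visit.

(** * Covering the quotient by visiting sets *)

Section index_pair_cover.
Context {R : realType} {X : metricType R} (phi : R -> X -> X).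
Context (I : set X) (n : nat) (M : 'I_n -> set X) (N L : set X).
Variable nu : set (pquot N L) -> \bar int.
Hypothesis flow_phi : is_flow phi.
Hypothesis morseM : morse_decomposition phi I M.
Hypothesis index_NL : index_pair phi I N L.
Hypothesis nuC : is_category R nu.
Notation Phi := (induced_semiflow phi).

Let semiflow_c : {within [set z : R * pquot N L | 0 <= z.1],
  continuous (fun z : R * pquot N L => Phi z.1 z.2)}.
Proof. by case: index_NL. Qed.

(** The points that [Phi T] does not send into [U0] form a compact set and each visits some [V i],
    so finitely many times detect all visits. [U0] is left free: a neighbourhood of the base point
    of the same category, or the base point alone when [L] is empty. *)
Lemma morse_cover (U0 : set (pquot N L)) : open U0 -> U0 None ->
  exists (T : R) (A : 'I_n -> set (pquot N L)), [/\ 0 <= T,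
    forall q, U0 (Phi T q) \/ (\bigcup_i A i) q &
    forall i, (nu (A i) <= nu (collapse N L @` M i))%E].
Proof.
move=> oU0 U0base; have phi0 := flow0 flow_phi.
have [[cN cL LN] [cK IK maxI] _] := index_NL.
set K := closure (N `\` L) in cK IK maxI.
have KN : K `<=` N.
  have /closure_id -> : closed N.
    by apply: compact_closed => //; exact: metric_hausdorff.
  by apply: closureS => x [].
have MN i : M i `<=` N.
  move=> x Mx; apply: KN; apply: (@interior_subset _ K); apply: IK.
  by case: morseM => _ /(_ i)[_ MI] _; exact: MI.
have DK : N `\` L `<=` K by exact: subset_closure.
(* [U i] has the category of the image of [M i]; [W i] lifts it to an open set of [X]. *)
have /choice[U UP] i := category_open nuC (collapse N L @` M i).
have /choice[W WP] i :
    exists W, open W /\ forall x, N x -> W x <-> U i (collapse N L x).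
  by have [oU _ _] := UP i; have [W] := pquot_open_preimage oU; exists W.
have MW i : M i `<=` W i.
  move=> x Mx; have [_ MU _] := UP i.
  by apply/(WP i).2; [exact: MN Mx|apply: MU; exists x].
have /choice[V VP] i := morse_no_return flow_phi cK maxI morseM i
  (fun i => (WP i).1) MW.
have [T T0 TP] := morse_capture flow_phi cK maxI morseM
  (fun i => let: And3 oV _ _ := VP i in oV)
  (fun i => let: And3 _ MV _ := VP i in MV).
have cT : continuous (Phi T : pquot N L -> pquot N L).
  by rewrite -(ger0_norm T0); exact: semiflow_continuous_at.
have cC : compact (~` (Phi T @^-1` U0)).
  apply: (subclosed_compact _ (pquot_compact cN)) => //.
  by apply/open_closedC/open_comp => // q _; exact: cT.
have [||q /= nU0|ts [e [e0 te]]] := @compact_uniform_positive R _ n R _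
  (fun i t q => visit (V i) (Phi `|t| q)) cC.
- move=> i t q; apply: (@continuous_comp _ _ _ (Phi `|t|) (visit (V i))).
    exact: semiflow_continuous_at.
  exact: visit_continuous.
- by move=> i t q; exact: visit_ge0.
- have [|x -> Dx] := @semiflow_neq_base _ _ _ _ phi T q T0.
    by move=> qT; apply: nU0; rewrite qT.
  have [s /andP[s0 sT] [i Vi]] := TP x (fun s sT => DK _ (Dx s sT)).
  exists i, s; rewrite ger0_norm// semiflow_collapse//.
    apply: visit_gt0 => //; last by apply: Dx; rewrite s0.
    by case: (VP i).
  by move=> r /andP[r0 rs]; apply: Dx; rewrite r0 (le_trans rs).
exists T, (fun i => [set q | e <= \sum_(t <- ts) visit (V i) (Phi `|t| q)]).
split=> // [q|i].
  have [|/te[i ei]] := pselect (U0 (Phi T q)); first by left.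
  by right; exists i.
have [_ _ ->] := UP i; apply: category_visit => // x t t0 Dx Vx Vt s st.
have [_ _ noret] := VP i.
apply/(WP i).2; first exact: (Dx s st).1.
by apply: (noret x t t0) => // r rt; apply: DK; exact: Dx.
Qed.

(* For empty L the base point is isolated in N/L, so no path reaches it. *)
Lemma semiflow_empty_exit (T : R) x : L = set0 -> 0 <= T -> N x ->
  Phi T (collapse N L x) <> None.
Proof.
move=> L0 T0 Nx PT; have phi0 := flow0 flow_phi.
have Dx : (N `\` L) x by rewrite L0 setD0.
pose f (t : R) := Phi `|t| (collapse N L x).
have cf : continuous f.
  apply: (@continuous_within_comp _ _ _ _ (fun t : R => (`|t|, collapse N L x))
    _ _ semiflow_c); first by move=> t /=.
  move=> t; apply: continuous_at_pair; first exact: norm_continuous.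
  exact: cst_continuous.
pose g (q : pquot N L) : R := if q is Some _ then 1 else 0.
have cg : continuous g by exact: pquot_base_indicator_continuous.
(* Along the orbit [g] would go from 1 to 0, yet it never takes the value 1/2. *)
have [||c _] := @IVT R (g \o f) 0 T (1 / 2) T0.
- apply: continuous_subspaceT => t; apply: (@continuous_comp _ _ _ f g).
    exact: cf.
  exact: cg.
- have gx : g (collapse N L x) = 1 by have [y _ ->] := collapse_in Dx.
  rewrite /= /f normr0 semiflow0// gx ger0_norm// PT /=.
  by rewrite min_r// max_l// divr_ge0//= ler_pdivrMr// mul1r ler1n.
rewrite /= /g; case: (f c) => [_|] /eqP.
  by rewrite gt_eqF// ltr_pdivrMr// mul1r ltr1n.
by rewrite lt_eqF// divr_gt0.
Qed.

End index_pair_cover.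

Theorem theorem3p1 (R : realType) (X : metricType R) (phi : R -> X -> X)
    (I : set X) (n : nat) (M : 'I_n -> set X) (N L : set X)
    (nu : set (pquot N L) -> \bar int) :
  is_flow phi ->
  isolated_invariant phi I ->
  (0 < n)%N ->
  morse_decomposition phi I M ->
  index_pair phi I N L ->
  is_category R nu ->
  (nu setT <= nu [set point] + \sum_(i < n) nu (collapse N L @` M i))%E /\
  (L = set0 ->
    (nu (collapse N L @` N) <= \sum_(i < n) nu (collapse N L @` M i))%E).
Proof.
move=> flow_phi _ n0 morseM index_NL nuC; split.
  have [U [oU bU ->]] := category_open nuC [set point].
  have [T [A [T0 QA AM]]] :=
    morse_cover flow_phi morseM index_NL nuC oU (bU _ erefl).
  have [[_ cL _] _ cPhi] := index_NL.
  (* The constant time [T] deforms the first set into [U], and the sets [A i] take the rest. *)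
  apply: (@le_trans _ _
    (nu (induced_semiflow phi T @^-1` U `|` \bigcup_i A i))).
    by apply: (category_mono nuC) => q _; exact: QA.
  apply: le_trans (category_subadd nuC _ _) _; apply: leeD.
    apply: (category_deform (flow0 flow_phi) cPhi nuC (tau := fun=> T)) => //.
    exact: cst_continuous.
  apply: le_trans (category_bigcup A nuC n0) _.
  by apply: lee_sum => i _; exact: AM.
move=> L0.
have oN : open [set None : pquot N L] by exact: (@pquot_open_base R).
have [T [A [T0 QA AM]]] := morse_cover flow_phi morseM index_NL nuC oN erefl.
apply: (@le_trans _ _ (nu (\bigcup_i A i))); last first.
  apply: le_trans (category_bigcup A nuC n0) _.
  by apply: lee_sum => i _; exact: AM.
(* No point of [N] reaches the base point, so the [A i] alone cover [N]. *)
apply: (category_mono nuC) => _ [x Nx <-].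
have [Phi_base|//] := QA (collapse N L x).
by have := semiflow_empty_exit flow_phi index_NL L0 T0 Nx.
Qed.
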